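(* Let $m,n$ be positive integers and let $q,z,u_1,\dots,u_n,v_1,\dots,v_m$ be complex parameters in general position. (I) For $n\ge m$, $$F_{n,m}^{trig(z)}(\overline u|\overline v)=\frac{\prod_{i=1}^m\prod_{k=1}^n(v_i-u_k)}{\prod_{1\le i<j\le m}(v_j-v_i)\prod_{1\le i<j\le n}(u_i-u_j)}\det_{1\le i,j\le n}(Y),$$ where $Y$ is the $n\times n$ matrix with $Y_{ij}=\frac{1}{v_i-u_j}-zq^{m-n}\frac{1}{v_i-qu_j}$ for $1\le i\le m$, $1\le j\le n$, and $Y_{ij}=u_j^{n-i}$ for $m+1\le i\le n$, $1\le j\le n$; and $$G_{n,m}^{trig(z)}(\overline u|\overline v)=\frac{(z;q)_\infty}{(q^{m-n}z;q)_\infty}\,\frac{\prod_{i=1}^m\prod_{k=1}^n(v_i-u_k)}{\prod_{1\le i<j\le m}(v_j-v_i)\prod_{1\le i<j\le n}(u_i-u_j)}\det_{1\le i,j\le n}(Z),$$ where $Z$ is the $n\times n$ matrix with $Z_{ij}=\frac{1}{v_i-u_j}-q^{m-n}z\frac{1}{v_i-qu_j}$ for $1\le i\le m$, $1\le j\le n$, and $Z_{ij}=u_j^{n-i}-q^{m-i}zu_j^{n-i}$ for $m+1\le i\le n$, $1\le j\le n$. (II) For $n<m$, $$F_{n,m}^{trig(z)}(\overline u|\overline v)=\frac{\prod_{i=1}^m\prod_{k=1}^n(u_k-v_i)}{\prod_{1\le i<j\le m}(v_i-v_j)\prod_{1\le i<j\le n}(u_j-u_i)}\det_{1\le i,j\le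 m}(U),$$ where $U$ is the $m\times m$ matrix with $U_{ij}=\frac{1}{u_i-v_j}-zq^{m-n}\frac{1}{qu_i-v_j}$ for $1\le i\le n$, $1\le j\le m$, and $U_{ij}=v_j^{m-i}-zq^{i-n-1}v_j^{m-i}$ for $n+1\le i\le m$, $1\le j\le m$; and $$G_{n,m}^{trig(z)}(\overline u|\overline v)=\frac{(z;q)_\infty}{(q^{m-n}z;q)_\infty}\,\frac{\prod_{i=1}^m\prod_{k=1}^n(u_k-v_i)}{\prod_{1\le i<j\le m}(v_i-v_j)\prod_{1\le i<j\le n}(u_j-u_i)}\det_{1\le i,j\le m}(V),$$ where $V$ is the $m\times m$ matrix with $V_{ij}=\frac{1}{u_i-v_j}-q^{m-n}z\frac{1}{qu_i-v_j}$ for $1\le i\le n$, $1\le j\le m$, and $V_{ij}=v_j^{m-i}$ for $n+1\le i\le m$, $1\le j\le m$.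
   Context: The factor $\frac{(z;q)_\infty}{(q^{m-n}z;q)_\infty}$ denotes $\prod_{j=0}^{m-n-1}(1-q^jz)$ if $n<m$, $1$ if $n=m$, and $\frac{1}{\prod_{j=1}^{n-m}(1-q^{-j}z)}$ if $n>m$. Write $[1,\dots,n]=\{1,\dots,n\}$, $|K|$ for the cardinality of a set $K$, $\overline u=\{u_1,\dots,u_n\}$, $\overline v=\{v_1,\dots,v_m\}$; $j\notin K$ means $j$ lies in the complement of $K$ in the index set over which subsets are taken. The trigonometric source functions are $$F_{n,m}^{trig(z)}(\overline u|\overline v)=\sum_{K\subset[1,\dots,m]}(-z)^{|K|}q^{|K|(|K|-1)/2}\prod_{i\in K,\,j\notin K}\frac{v_i-qv_j}{v_i-v_j}\prod_{i\in K,\,1\le k\le n}\frac{v_i-u_k}{v_i-qu_k},$$ $$G_{n,m}^{trig(z)}(\overline u|\overline v)=\frac{(z;q)_\infty}{(q^{m-n}z;q)_\infty}\sum_{K\subset[1,\dots,n]}(-q^{m-n}z)^{|K|}q^{|K|(|K|-1)/2}\prod_{i\in K,\,j\notin K}\frac{qu_i-u_j}{u_i-u_j}\prod_{i\in K,\,1\le k\le m}\frac{v_k-u_i}{v_k-qu_i}.$$ ''In general position'' means $q\neq0$ and that zeros of all factors in denominators are avoided. *)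

(* Defs.v *)
From mathcomp Require Export all_boot all_order all_algebra reals complex.

Set Implicit Arguments.
Unset Strict Implicit.
Unset Printing Implicit Defensive.

Import GRing.Theory.
Local Open Scope ring_scope.

(* Indices are 0-based: the entry [u`_k] of the n-tuple [u] is u_(k+1), and
   row [i] of a matrix is row i+1 of the usual 1-based description. *)

Section TrigonometricSource.

Variables (C : fieldType) (n m : nat).
Implicit Types (q z : C) (u : n.-tuple C) (v : m.-tuple C).

Definition qmn q : C := q ^ (m%:Z - n%:Z).

(* The factor (z;q)_oo / (q^(m-n) z;q)_oo, as a finite product. *)
Definition qpoch_ratio q z : C :=
  if (n < m)%N then \prod_(0 <= j < m - n) (1 - q ^+ j * z)
  else if n == m then 1
  else (\prod_(1 <= j < (n - m).+1) (1 - q ^- j * z))^-1.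

Definition Ftrig q z u v : C :=
  \sum_(K : {set 'I_m})
    (- z) ^+ #|K| * q ^+ (#|K| * (#|K|).-1)%N./2
    * (\prod_(i in K) \prod_(j | j \notin K)
         ((v`_i - q * v`_j) / (v`_i - v`_j)))
    * (\prod_(i in K) \prod_(k < n) ((v`_i - u`_k) / (v`_i - q * u`_k))).

Definition Gtrig q z u v : C :=
  qpoch_ratio q z *
  \sum_(K : {set 'I_n})
    (- (qmn q * z)) ^+ #|K| * q ^+ (#|K| * (#|K|).-1)%N./2
    * (\prod_(i in K) \prod_(j | j \notin K)
         ((q * u`_i - u`_j) / (u`_i - u`_j)))
    * (\prod_(i in K) \prod_(k < m) ((v`_k - u`_i) / (v`_k - q * u`_i))).

(* q <> 0, and no factor of a denominator occurring in the source functions,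
   in the Cauchy-type prefactors or in the matrices below vanishes. *)
Definition general_position q z u v : Prop :=
  [/\ q != 0,
      forall i j : 'I_n, i != j -> u`_i - u`_j != 0,
      forall i j : 'I_m, i != j -> v`_i - v`_j != 0,
      forall (i : 'I_m) (k : 'I_n),
        v`_i - u`_k != 0 /\ v`_i - q * u`_k != 0
    & forall j : nat, (1 <= j <= n - m)%N -> 1 - q ^- j * z != 0].

(* [_ge] is used for m <= n, [_lt] for n < m. *)
Definition prefactor_ge u v : C :=
  (\prod_(i < m) \prod_(k < n) (v`_i - u`_k))
  / ((\prod_(i < m) \prod_(j < m | (i < j)%N) (v`_j - v`_i))
     * (\prod_(i < n) \prod_(j < n | (i < j)%N) (u`_i - u`_j))).

Definition prefactor_lt u v : C :=
  (\prod_(i < m) \prod_(k < n) (u`_k - v`_i))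
  / ((\prod_(i < m) \prod_(j < m | (i < j)%N) (v`_i - v`_j))
     * (\prod_(i < n) \prod_(j < n | (i < j)%N) (u`_j - u`_i))).

Definition matY q z u v : 'M[C]_n :=
  \matrix_(i < n, j < n)
    if (i < m)%N then
      (v`_i - u`_j)^-1 - z * qmn q * (v`_i - q * u`_j)^-1
    else u`_j ^+ (n - i.+1).

Definition matZ q z u v : 'M[C]_n :=
  \matrix_(i < n, j < n)
    if (i < m)%N then
      (v`_i - u`_j)^-1 - qmn q * z * (v`_i - q * u`_j)^-1
    else u`_j ^+ (n - i.+1)
         - q ^ (m%:Z - (i.+1)%:Z) * z * u`_j ^+ (n - i.+1).

Definition matU q z u v : 'M[C]_m :=
  \matrix_(i < m, j < m)
    if (i < n)%N then
      (u`_i - v`_j)^-1 - z * qmn q * (q * u`_i - v`_j)^-1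
    else v`_j ^+ (m - i.+1)
         - z * q ^ ((i.+1)%:Z - n%:Z - 1) * v`_j ^+ (m - i.+1).

Definition matV q z u v : 'M[C]_m :=
  \matrix_(i < m, j < m)
    if (i < n)%N then
      (u`_i - v`_j)^-1 - qmn q * z * (q * u`_i - v`_j)^-1
    else v`_j ^+ (m - i.+1).

End TrigonometricSource.

Arguments qpoch_ratio {C} n m q z.

(* Main.v *)
Require Import Defs.
From mathcomp Require Import all_boot all_order all_algebra.
From mathcomp Require Import reals complex.
From mathcomp Require Import perm ring zify.

(** Each of the four determinants is a multilinear expansion over the
Cauchy-Vandermonde determinant.  For [m <= n], let [CVmx m n x y] be the
n-by-n matrix with the m Cauchy rows [1 / (x_i - y_j)] followed by the power
rows [y_j ^ (n - m - 1), ..., y_j, 1].  Its determinant ([det_CVmx]) is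
<<
  prod_(i < j) (x_j - x_i) * prod_(i < j) (y_i - y_j) / prod_(i, k) (x_i - y_k).
>>
In the matrices Y and V, the i-th Cauchy row has the form r(x_i) - w r(p x_i),
where r(x) is the row of a Cauchy-Vandermonde matrix with node x; in Z and U
it is the columns that have the form c(y_j) - w c(p y_j): the extra factors
on the power rows are exactly those which make this work.  Here p is q or
1/q.  Expanding each determinant by multilinearity over the set K of rows, or
of columns, in which the second term is taken, gives
  sum_K (- w) ^ |K| det (CV matrix in which the nodes of K are scaled by p)
([det_rows], [det_cols]).  Divided by the unscaled determinant, the summand of
K is a ratio of products.  A pair of nodes contributes p when both lie in K
and (p x_i - x_j) / (x_i - x_j) when only i does, which gives the power
p ^ (|K| (|K| - 1) / 2) and the double product over K and its complement
([vandermonde_scale]); the mixed differences give the last product.  So both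
expansions produce the same kind of sum, [source_sum]: over subsets of the
Cauchy nodes in [source_rows], of the power nodes in [source_cols].

The function G is such a sum with p = q, times the ratio of q-Pochhammer
symbols that stands on both sides, and F is one with p = 1/q, once the powers of q are collected ([inverse_weight]).  Exchanging the
roles of u and v exchanges the cases m <= n and n < m. *)

Set Implicit Arguments.
Unset Strict Implicit.
Unset Printing Implicit Defensive.
Import GRing.Theory.
Local Open Scope ring_scope.
Local Open Scope complex_scope.

(** * The Cauchy-Vandermonde determinant *)

(** The nodes are functions on [nat], of which only the first values matter, so
that a node can be dropped without changing types. *)
Definition CVmx (C : fieldType) (m n : nat) (x y : nat -> C) : 'M[C]_n :=
  \matrix_(i < n, j < n)
    if (i < m)%N then (x i - y j)^-1 else y j ^+ (n - i.+1).

Lemma det_uptrig (C : comNzRingType) n (M : 'M[C]_n) :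
  (forall i j : 'I_n, (j < i)%N -> M i j = 0) -> \det M = \prod_(i < n) M i i.
Proof.
move=> M0; rewrite -det_tr det_trig; first by apply: eq_bigr => i _; rewrite mxE.
by apply/is_trig_mxP => i j lt_ij; rewrite mxE M0.
Qed.

Lemma det_scale_cols (C : comNzRingType) n (M : 'M[C]_n) (d : 'I_n -> C) :
  \det (\matrix_(i, j) (M i j * d j)) = \det M * \prod_(j < n) d j.
Proof.
have -> : \matrix_(i, j) (M i j * d j) = M *m diag_mx (\row_j d j).
  by rewrite mul_mx_diag; apply/matrixP => i j; rewrite !mxE.
by rewrite det_mulmx det_diag; congr (_ * _); apply: eq_bigr => j _; rewrite mxE.
Qed.

(** Row operations make the last column zero above its bottom entry 1.  The
bottom row is y^0, so subtracting it turns (x_i - y_n) / (x_i - y_j) into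
(y_j - y_n) / (x_i - y_j), and subtracting y_n times the next power row gives
y_j^a (y_j - y_n); column j then carries the factor y_j - y_n.  The matrix [L]
of these operations is upper triangular. *)
Lemma det_CVmx_drop_y (C : fieldType) m n (x y : nat -> C) :
  (m <= n)%N -> (forall i, (i < m)%N -> x i != y n) ->
  (forall i j, (i < m)%N -> (j < n)%N -> x i != y j) ->
  (\prod_(i < m) (x i - y n)) * \det (CVmx m n.+1 x y)
    = \det (CVmx m n x y) * \prod_(j < n) (y j - y n).
Proof.
move=> le_mn xn xy.
pose L : 'M[C]_n.+1 := \matrix_(i, j)
  if (i < m)%N then (x i - y n) *+ (i == j) - (j == ord_max)%:R
  else (i == j)%:R - y n *+ (j == i.+1 :> nat).
have detL : \det L = \prod_(i < m) (x i - y n).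
  rewrite det_uptrig; last first.
    move=> i j lt_ji; rewrite mxE.
    have /negPf-> : i != j by rewrite -val_eqE neq_ltn lt_ji orbT.
    rewrite (ltn_eqF (ltn_trans lt_ji _)) //.
    have /negPf-> : j != ord_max.
      by rewrite -val_eqE neq_ltn (leq_trans lt_ji) // -ltnS.
    by rewrite !mulr0n subr0 if_same.
  rewrite (bigID (fun i : 'I_n.+1 => (i < m)%N)) /= [X in _ * X]big1 ?mulr1.
    rewrite (big_ord_narrow (leqW le_mn)); apply: eq_bigr => i _.
    rewrite mxE /= ltn_ord eqxx.
    by rewrite -val_eqE /= (ltn_eqF (leq_trans (ltn_ord i) le_mn)) subr0.
  move=> i /negPf ge_im; rewrite mxE ge_im eqxx.
  by rewrite (ltn_eqF (ltnSn i)) subr0.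
rewrite -detL -det_mulmx.
(* the entries of N in the last column vanish above the bottom one *)
pose N : 'M[C]_n.+1 := L *m CVmx m n.+1 x y.
have NE i j : N i j = if (i < m)%N then (y j - y n) / (x i - y j)
   else if (i < n)%N then y j ^+ (n - i.+1) * (y j - y n) else 1.
  rewrite mxE.
  case: ifP => im.
    have -> : \sum_j0 L i j0 * CVmx m n.+1 x y j0 j =
       \sum_j0 (if j0 == i then (x i - y n) * CVmx m n.+1 x y j0 j else 0)
       - \sum_j0 (if j0 == ord_max then CVmx m n.+1 x y j0 j else 0).
      rewrite -sumrB; apply: eq_bigr => k _; rewrite mxE im mulrBl.
      rewrite eq_sym; case: eqP => [->|]; case: eqP; rewrite ?mulr1n ?mulr0n;
        by rewrite ?mul0r ?mul1r.
    rewrite -!big_mkcond !big_pred1_eq !mxE im /= ltnNge le_mn /= subnn expr0.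
    have: x i - y j != 0.
      rewrite subr_eq0; have := ltn_ord j; rewrite ltnS leq_eqVlt.
      by case/orP => [/eqP->|jn]; [apply: xn | apply: xy].
    by move=> h; field.
  case: ifP => i_n.
    pose i1 : 'I_n.+1 := inord i.+1.
    have i1E : i1 = i.+1 :> nat by rewrite inordK.
    have -> : \sum_j0 L i j0 * CVmx m n.+1 x y j0 j =
       \sum_j0 (if j0 == i then CVmx m n.+1 x y j0 j else 0)
       - \sum_j0 (if j0 == i1 then y n * CVmx m n.+1 x y j0 j else 0).
      rewrite -sumrB; apply: eq_bigr => k _; rewrite mxE im mulrBl.
      rewrite eq_sym -i1E val_eqE; case: eqP => [->|]; case: eqP; rewrite ?mulr1n ?mulr0n;
        by rewrite ?mul0r ?mul1r.
    rewrite -!big_mkcond !big_pred1_eq !mxE im i1E /=.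
    have -> : (i.+1 < m)%N = false by apply: negbTE; rewrite -leqNgt ltnW // ltnS leqNgt im.
    by rewrite !subSS -(subnSK i_n) exprS; ring.
  have -> : i = ord_max.
    by apply/val_inj/eqP; rewrite eqn_leq -ltnS ltn_ord /= leqNgt i_n.
  rewrite (bigD1 ord_max) //= big1 ?addr0.
    rewrite !mxE /= ltnNge le_mn /= eqxx (ltn_eqF (ltnSn n)) subnn subr0.
    by rewrite mul1r.
  move=> k; rewrite mxE /= ltnNge le_mn /= eq_sym => /negPf->.
  by rewrite (ltn_eqF (ltn_ord k)) subr0 mul0r.
rewrite -/N (expand_det_col _ ord_max) (bigD1 ord_max) //= big1 ?addr0.
  rewrite NE /= ltnNge le_mn ltnn mul1r /cofactor addnn -signr_odd odd_double.
  rewrite expr0 mul1r -det_scale_cols; congr (\det _).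
  apply/matrixP => i j; rewrite 2!mxE NE !mxE /= /bump.
  rewrite !(leqNgt n) !ltn_ord /= !add0n.
  by case: ifP => _ //; rewrite mulrC.
move=> i; rewrite NE /= subrr -val_eqE /= mul0r mulr0 => ne_in.
have lt_in : (i < n)%N by rewrite ltn_neqAle ne_in -ltnS ltn_ord.
by rewrite lt_in if_same mul0r.
Qed.

(** With as many Cauchy rows as columns there is no row of ones to start from;
multiplying column j by x_n - y_j creates one out of the last row.  Since
(x_n - y) / (x_i - y) = 1 + (x_n - x_i) / (x_i - y), the result is an upper
triangular matrix times a matrix with one Cauchy row fewer. *)
Lemma det_CVmx_drop_x (C : fieldType) n (x y : nat -> C) :
  (forall i j, (i < n.+1)%N -> (j < n.+1)%N -> x i != y j) ->
  \det (CVmx n.+1 n.+1 x y) * \prod_(j < n.+1) (x n - y j)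
    = (\prod_(i < n) (x n - x i)) * \det (CVmx n n.+1 x y).
Proof.
move=> xy.
pose B : 'M[C]_n.+1 := \matrix_(i, j)
  if (i < n)%N then (x n - x i) *+ (i == j) + (j == ord_max)%:R
  else (i == j)%:R.
have detB : \det B = \prod_(i < n) (x n - x i).
  rewrite det_uptrig; last first.
    move=> i j lt_ji; rewrite mxE.
    have /negPf-> : i != j by rewrite -val_eqE neq_ltn lt_ji orbT.
    have /negPf-> : j != ord_max.
      by rewrite -val_eqE neq_ltn (leq_trans lt_ji) // -ltnS.
    by rewrite !mulr0n addr0 if_same.
  rewrite big_ord_recr /= mxE ltnn eqxx mulr1; apply: eq_bigr => i _.
  by rewrite mxE /= ltn_ord eqxx -val_eqE /= (ltn_eqF (ltn_ord i)) addr0.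
rewrite -detB -det_mulmx -det_scale_cols; congr (\det _).
apply/matrixP => i j; rewrite mxE [RHS]mxE [in LHS]mxE ltn_ord.
have xyn0 k : (k < n.+1)%N -> x k - y j != 0 by move=> kn; rewrite subr_eq0 xy.
have [i_n|le_ni] := ltnP i n.
  have -> : \sum_j0 B i j0 * CVmx n n.+1 x y j0 j =
     \sum_j0 (if j0 == i then (x n - x i) * CVmx n n.+1 x y j0 j else 0)
     + \sum_j0 (if j0 == ord_max then CVmx n n.+1 x y j0 j else 0).
    rewrite -big_split; apply: eq_bigr => k _; rewrite mxE i_n mulrDl.
    rewrite eq_sym; case: eqP => [->|]; case: eqP; rewrite ?mulr1n ?mulr0n;
      by rewrite ?mul0r ?mul1r.
  rewrite -!big_mkcond !big_pred1_eq !mxE i_n /= ltnn subnn expr0.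
  by have := xyn0 i (ltn_ord i) => h; field.
have -> : i = ord_max.
  by apply/val_inj/eqP; rewrite eqn_leq -ltnS ltn_ord.
rewrite (bigD1 ord_max) //= big1 ?addr0.
  rewrite !mxE /= ltnn eqxx subnn mul1r expr0 mulVf // xyn0 //.
move=> k; rewrite mxE /= ltnn eq_sym => /negPf->.
by rewrite mul0r.
Qed.

Lemma prod_pairs_recr (C : comNzRingType) n (g : nat -> nat -> C) :
  \prod_(i < n.+1) \prod_(j < n.+1 | (i < j)%N) g i j
  = (\prod_(i < n) \prod_(j < n | (i < j)%N) g i j) * \prod_(i < n) g i n.
Proof.
rewrite big_ord_recr /= [X in _ * X]big1 ?mulr1; last first.
  by move=> j; rewrite ltnNge -ltnS ltn_ord.
rewrite -big_split; apply: eq_bigr => i _.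
by rewrite big_mkcond big_ord_recr /= -big_mkcond ltn_ord.
Qed.

(** Induction on [n]: the last y is dropped while [m < n.+1]; when [m] reaches
[n.+1], the last x has to go first. *)
Lemma det_CVmx (C : fieldType) m n (x y : nat -> C) : (m <= n)%N ->
  (forall i j, (i < m)%N -> (j < n)%N -> x i != y j) ->
  \det (CVmx m n x y) * \prod_(i < m) \prod_(k < n) (x i - y k)
  = (\prod_(i < m) \prod_(j < m | (i < j)%N) (x j - x i))
    * (\prod_(i < n) \prod_(j < n | (i < j)%N) (y i - y j)).
Proof.
elim: n m => [|n IHn] m.
  by rewrite leqn0 => /eqP-> _; rewrite det_mx00 !big_ord0.
have stepcol m' : (m' <= n)%N ->
    (forall i j, (i < m')%N -> (j < n.+1)%N -> x i != y j) ->
    \det (CVmx m' n.+1 x y) * \prod_(i < m') \prod_(k < n.+1) (x i - y k)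
    = (\prod_(i < m') \prod_(j < m' | (i < j)%N) (x j - x i))
      * (\prod_(i < n.+1) \prod_(j < n.+1 | (i < j)%N) (y i - y j)).
  move=> le_m'n xy.
  rewrite (@prod_pairs_recr _ n (fun i j => y i - y j)) mulrA -IHn //; last first.
    by move=> i j im jn; apply: xy => //; apply: ltnW.
  under eq_bigr do rewrite big_ord_recr.
  rewrite big_split /= [RHS]mulrAC -det_CVmx_drop_y //; first by ring.
  - by move=> i im; apply: xy.
  - by move=> i j im jn; apply: xy => //; apply: ltnW.
rewrite leq_eqVlt => /orP[/eqP-> xy|]; last by rewrite ltnS; apply: stepcol.
rewrite (@prod_pairs_recr _ n (fun i j => x j - x i)) mulrAC -stepcol //; last first.
  by move=> i j im; apply: xy; apply: ltnW.
rewrite [in LHS]big_ord_recr /= mulrCA [X in _ * X]det_CVmx_drop_x //.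
by ring.
Qed.

(** * Scaling some of the nodes *)

(** Membership of the underlying natural number is tested because the nodes
are functions on [nat]. *)
Definition scale_on (C : fieldType) (p : C) n (K : {set 'I_n}) (f : nat -> C) :=
  fun i : nat => if i \in [seq val k | k in K] then p * f i else f i.

Lemma scale_onE (C : fieldType) (p : C) n (K : {set 'I_n}) f (i : 'I_n) :
  scale_on p K f i = if i \in K then p * f i else f i.
Proof. by rewrite /scale_on (mem_image val_inj). Qed.

(** The common shape of F and G: [p] is the factor by which the nodes [x] indexed
by K are scaled, and [- w] the weight of each of them. *)
Definition source_sum (C : fieldType) (p w : C) a b (x y : nat -> C) : C :=
  \sum_(K : {set 'I_a})
    (- w) ^+ #|K| * p ^+ (#|K| * (#|K|).-1)%N./2
    * (\prod_(i in K) \prod_(j | j \notin K) ((p * x i - x j) / (x i - x j)))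
    * (\prod_(i in K) \prod_(k < b) ((x i - y k) / (p * x i - y k))).

(** Turns products over pairs [i < j] of a quantity symmetric in i and j into
products over all ordered pairs, where the condition that i lies in K and j
does not can be read off. *)
Lemma big_pairs (R : Type) (idx : R) (op : Monoid.com_law idx) n
    (F : 'I_n -> 'I_n -> R) :
  \big[op/idx]_(i < n) \big[op/idx]_(j < n | j != i) F i j
  = \big[op/idx]_(i < n) \big[op/idx]_(j < n | (i < j)%N) op (F i j) (F j i).
Proof.
under [RHS]eq_bigr do rewrite big_split.
rewrite big_split /= [X in op _ X](exchange_big_dep xpredT) //= -big_split /=.
apply: eq_bigr => i _; rewrite (bigID (fun j : 'I_n => (i < j)%N)) /=.
by congr (op _ _); apply: eq_bigl => j; rewrite -val_eqE neq_ltn;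
   case: ltngtP.
Qed.

Lemma card_pairs n (K : {set 'I_n}) :
  (\sum_(i < n) \sum_(j < n | (i < j)%N) ((i \in K) && (j \in K))
   = (#|K| * #|K|.-1)./2)%N.
Proof.
have := @big_pairs _ 0%N addn n (fun i j => (i \in K) && (j \in K) : nat).
under [RHS]eq_bigr do under eq_bigr do rewrite /= [(_ \in K) && (_ \in K) in X in (_ + X)%N]andbC addnn -mul2n.
under [RHS]eq_bigr do rewrite -big_distrr /=.
rewrite -big_distrr /= => E.
rewrite -[LHS](doubleK) -mul2n -E; congr (_./2).
rewrite [LHS](bigID (mem K)) /= [X in (_ + X)%N]big1 ?addn0; last first.
  by move=> i /negPf iK; rewrite big1 // => j _; rewrite iK.
rewrite -sum_nat_const; apply: eq_bigr => i iK.
rewrite iK (cardsD1 i K) iK /= -sum1_card big_mkcond [RHS]big_mkcond /=.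
by apply: eq_bigr => j _; rewrite !inE; case: eqP => //= _; case: (j \in K).
Qed.

(** A pair with both indices in K contributes [p], a pair with none contributes
1, and a pair with exactly one of them in K contributes the factor [F] read in
the direction from K to its complement. *)
Lemma vandermonde_scale (C : fieldType) (p : C) n (K : {set 'I_n}) (f : nat -> C) :
  (forall i j : 'I_n, i != j -> f i - f j != 0) ->
  \prod_(i < n) \prod_(j < n | (i < j)%N)
     ((scale_on p K f i - scale_on p K f j) / (f i - f j))
  = p ^+ (#|K| * (#|K|).-1)%N./2
    * \prod_(i in K) \prod_(j | j \notin K) ((p * f i - f j) / (f i - f j)).
Proof.
move=> fD.
pose F i j : C := if (i \in K) && (j \notin K)
  then (p * f (val i) - f (val j)) / (f (val i) - f (val j)) else 1.
transitivity ((\prod_(i < n) \prod_(j < n | (i < j)%N) p ^+ ((i \in K) && (j \in K)))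
  * \prod_(i < n) \prod_(j < n | (i < j)%N) (F i j * F j i)).
  rewrite -big_split; apply: eq_bigr => i _.
  rewrite -big_split; apply: eq_bigr => j lt_ij /=.
  have ne : i != j by rewrite -val_eqE neq_ltn lt_ij.
  have := fD _ _ ne; have := fD j i; rewrite eq_sym => /(_ ne) h1 h2.
  rewrite !scale_onE /F; case: (i \in K); case: (j \in K) => /=;
    rewrite ?expr1 ?expr0; by field; rewrite ?h1 ?h2.
congr (_ * _).
  rewrite -card_pairs; under eq_bigr do rewrite prodrXr.
  by rewrite prodrXr.
rewrite -big_pairs [RHS]big_mkcond /=; apply: eq_bigr => i _.
rewrite /F; case iK : (i \in K) => /=; last by rewrite big1.
rewrite big_mkcond [RHS]big_mkcond; apply: eq_bigr => j _ /=.
by case: eqP => [->|_] //=; rewrite iK.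
Qed.

(** * Multilinear expansions *)

(** Distributivity when only the first [m] of [n] factors are sums; stated on
factors rather than on determinants so that the subsets are those of ['I_m]. *)
Lemma prod_add_prefix (C : comNzRingType) m n (F G H : 'I_n -> C) : (m <= n)%N ->
  \prod_(i < n) (if (i < m)%N then F i + G i else H i)
  = \sum_(K : {set 'I_m}) \prod_(i < n)
      (if (i < m)%N then if (i : nat) \in [seq val k | k in K] then G i else F i
       else H i).
Proof.
move=> le_mn; rewrite (bigID (fun i : 'I_n => (i < m)%N)) /=.
rewrite big_ord_narrow.
under [X in X * _ = _]eq_bigr do rewrite /= ltn_ord addrC.
rewrite bigA_distr big_distrl; apply: eq_bigr => K _ /=.
rewrite [RHS](bigID (fun i : 'I_n => (i < m)%N)) /= big_ord_narrow.
congr (_ * _).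
  by apply: eq_bigr => i _; rewrite /= ltn_ord (mem_image val_inj).
by apply: eq_bigr => i /negPf->.
Qed.

Lemma prod_mask_const (C : comNzRingType) m n (K : {set 'I_m}) (a : C) :
  (m <= n)%N ->
  \prod_(i < n) (if (i : nat) \in [seq val k | k in K] then a else 1) = a ^+ #|K|.
Proof.
move=> le_mn; rewrite (bigID (fun i : 'I_n => (i < m)%N)) /=.
rewrite big_ord_narrow [X in _ * X]big1 ?mulr1; last first.
  move=> i nim; case: ifP => // /imageP[k _ ik].
  by case/negP: nim; rewrite ik /=.
under eq_bigr do rewrite /= (mem_image val_inj).
by rewrite -big_mkcond prodr_const.
Qed.

Lemma det_rows (C : fieldType) (p w : C) m n (x y : nat -> C) : (m <= n)%N ->
  \det (\matrix_(i < n, j < n)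
    if (i < m)%N then (x i - y j)^-1 - w * (p * x i - y j)^-1
    else y j ^+ (n - i.+1))
  = \sum_(K : {set 'I_m}) (- w) ^+ #|K| * \det (CVmx m n (scale_on p K x) y).
Proof.
move=> le_mn.
under [RHS]eq_bigr do rewrite /determinant big_distrr /=.
rewrite exchange_big; apply: eq_bigr => s _ /=.
under eq_bigr do rewrite mxE -mulNr.
rewrite prod_add_prefix // big_distrr; apply: eq_bigr => K _ /=.
rewrite mulrCA; congr (_ * _).
rewrite -(prod_mask_const K (- w) le_mn) -big_split; apply: eq_bigr => i _ /=.
rewrite mxE /scale_on; case: ifP => im; first by case: ifP; rewrite ?mul1r.
case: ifP; rewrite ?mul1r // => /imageP[k _ ik].
by move: im; rewrite ik /= ltn_ord.
Qed.

(** The power rows carry the scaled term as well, so that every column is the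
difference of a column at [y j] and [w] times the column at [p * y j]. *)
Lemma det_cols (C : fieldType) (p w : C) m n (x y : nat -> C) :
  \det (\matrix_(i < n, j < n)
    if (i < m)%N then (x i - y j)^-1 - w * (x i - p * y j)^-1
    else y j ^+ (n - i.+1) - w * (p * y j) ^+ (n - i.+1))
  = \sum_(K : {set 'I_n}) (- w) ^+ #|K| * \det (CVmx m n x (scale_on p K y)).
Proof.
rewrite -det_tr.
under [RHS]eq_bigr do rewrite -det_tr /determinant big_distrr /=.
rewrite exchange_big; apply: eq_bigr => s _ /=.
pose c (a : C) (i : nat) := if (i < m)%N then (x i - a)^-1 else a ^+ (n - i.+1).
move: (s : {perm 'I_n}) => {}s.
transitivity ((-1) ^+ s *
    \prod_(j < n) (- w * c (p * y j) (s j) + c (y j) (s j))).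
  congr (_ * _); apply: eq_bigr => j _; rewrite !mxE /c.
  by case: ifP => _; rewrite mulNr addrC.
rewrite bigA_distr big_distrr; apply: eq_bigr => K _ /=.
rewrite mulrCA; congr (_ * _).
rewrite -(prod_mask_const K (- w) (leqnn n)) -big_split; apply: eq_bigr => j _ /=.
rewrite !mxE /c scale_onE (mem_image val_inj).
by case: ifP => _; rewrite ?mul1r.
Qed.

(** The inverse of the Cauchy-Vandermonde determinant. *)
Definition CVprefactor (C : fieldType) m n (x y : nat -> C) : C :=
  (\prod_(i < m) \prod_(k < n) (x i - y k))
  / ((\prod_(i < m) \prod_(j < m | (i < j)%N) (x j - x i))
     * (\prod_(i < n) \prod_(j < n | (i < j)%N) (y i - y j))).

Lemma prod2_neq0 (C : fieldType) (I J : finType) (P : I -> pred J) (F : I -> J -> C) :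
  (forall i j, P i j -> F i j != 0) -> \prod_i \prod_(j | P i j) F i j != 0.
Proof.
by move=> F0; apply/prodf_neq0 => i _; apply/prodf_neq0 => j; apply: F0.
Qed.

Lemma prod2_div (C : fieldType) (I J : finType) (P : I -> pred J) (F G : I -> J -> C) :
  \prod_i \prod_(j | P i j) (F i j / G i j)
  = (\prod_i \prod_(j | P i j) F i j) / (\prod_i \prod_(j | P i j) G i j).
Proof. by under eq_bigr do rewrite prodf_div; rewrite prodf_div. Qed.

(** * Determinant formulas for source sums *)

Section SourceSums.
Variables (C : fieldType) (m n : nat) (x y : nat -> C).
Hypotheses (le_mn : (m <= n)%N)
  (xD : forall i j : 'I_m, i != j -> x i - x j != 0)
  (yD : forall i j : 'I_n, i != j -> y i - y j != 0)
  (xyD : forall (i : 'I_m) (j : 'I_n), x i - y j != 0).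

Let DX (x : nat -> C) := \prod_(i < m) \prod_(j < m | (i < j)%N) (x j - x i).
Let DY (y : nat -> C) := \prod_(i < n) \prod_(j < n | (i < j)%N) (y i - y j).
Let XY (x y : nat -> C) := \prod_(i < m) \prod_(k < n) (x i - y k).

Lemma CVprefactor_det (x' y' : nat -> C) :
  (forall (i : 'I_m) (j : 'I_n), x' i - y' j != 0) ->
  CVprefactor m n x y * \det (CVmx m n x' y')
  = (DX x' / DX x) * (DY y' / DY y) * (XY x y / XY x' y').
Proof.
move=> D'; have XY0 : XY x' y' != 0 by apply: prod2_neq0 => i j _; apply: D'.
have E : \det (CVmx m n x' y') * XY x' y' = DX x' * DY y'.
  apply: det_CVmx => // i j im jn.
  by have := D' (Ordinal im) (Ordinal jn); rewrite subr_eq0.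
have -> : \det (CVmx m n x' y') = DX x' * DY y' / XY x' y'.
  by rewrite -E mulfK.
rewrite /CVprefactor -/(XY x y) -/(DX x) -/(DY y) invfM; ring.
Qed.

Lemma DX0 : DX x != 0.
Proof.
by apply: prod2_neq0 => i j lt; apply: xD; rewrite -val_eqE neq_ltn lt orbT.
Qed.
Lemma DY0 : DY y != 0.
Proof. by apply: prod2_neq0 => i j lt; apply: yD; rewrite -val_eqE neq_ltn lt. Qed.

(** Scaling the Cauchy nodes leaves the Vandermonde product of [y] unchanged, so
the ratio of determinants is a summand of [source_sum] over subsets of x. *)
Lemma source_rows p w :
  (forall (i : 'I_m) (j : 'I_n), p * x i - y j != 0) ->
  source_sum p w m n x y = CVprefactor m n x y *
  \det (\matrix_(i < n, j < n)
    if (i < m)%N then (x i - y j)^-1 - w * (p * x i - y j)^-1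
    else y j ^+ (n - i.+1)).
Proof.
move=> pD; rewrite det_rows // big_distrr; apply: eq_bigr => K _ /=.
rewrite mulrCA CVprefactor_det; last by move=> i j; rewrite scale_onE; case: ifP.
rewrite divff ?DY0 // mulr1 -(mulrA (_ ^+ _)) -vandermonde_scale // -[LHS]mulrA.
congr (_ * (_ * _)).
  rewrite -prod2_div; apply: eq_bigr => i _; apply: eq_bigr => j _.
  by rewrite -opprB -(opprB (x j)) invrN mulrNN.
rewrite /XY -(prod2_div (fun _ => xpredT)) big_mkcond; apply: eq_bigr => i _ /=.
rewrite scale_onE; case: ifP => // _; rewrite big1 // => j _.
by rewrite divff.
Qed.

(** Here the Vandermonde product of [x] is the unchanged one, so the roles of the
two families in [source_sum] are exchanged. *)
Lemma source_cols p w :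
  (forall (i : 'I_m) (j : 'I_n), x i - p * y j != 0) ->
  source_sum p w n m y x = CVprefactor m n x y *
  \det (\matrix_(i < n, j < n)
    if (i < m)%N then (x i - y j)^-1 - w * (x i - p * y j)^-1
    else y j ^+ (n - i.+1) - w * (p * y j) ^+ (n - i.+1)).
Proof.
move=> pD; rewrite det_cols big_distrr; apply: eq_bigr => K _ /=.
rewrite mulrCA CVprefactor_det; last by move=> i j; rewrite scale_onE; case: ifP.
rewrite divff ?DX0 // mul1r -(mulrA (_ ^+ _)) -vandermonde_scale // -[LHS]mulrA.
congr (_ * (_ * _)).
  by rewrite -prod2_div.
rewrite /XY -(prod2_div (fun _ => xpredT)) [RHS]exchange_big big_mkcond; apply: eq_bigr => i _ /=.
rewrite scale_onE; case: ifP => _; last by rewrite big1 // => j _; rewrite divff.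
by apply: eq_bigr => j _; rewrite -opprB -(opprB (x j)) invrN mulrNN.
Qed.
End SourceSums.

(** * The trigonometric source functions as source sums *)

Lemma qmnM (C : fieldType) n m (q : C) : q != 0 -> qmn n m q * q ^+ n = q ^+ m.
Proof. by move=> q0; rewrite /qmn !exprnP -expfzDr // subrK. Qed.

Lemma qmn_pow (C : fieldType) n m (q : C) i : q != 0 -> (i < n)%N ->
  qmn n m q * q ^+ (n - i.+1) = q ^ (m%:Z - i.+1%:Z).
Proof.
move=> q0 lt_in; rewrite /qmn exprnP -expfzDr // -subzn //; congr (_ ^ _); ring.
Qed.

Lemma qmn_powV (C : fieldType) n m (q : C) i : q != 0 -> (i < m)%N ->
  qmn n m q / q * q^-1 ^+ (m - i.+1) = q ^ (i.+1%:Z - n%:Z - 1).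
Proof.
move=> q0 lt_in; rewrite /qmn exprVn -mulrA -invfM -exprS exprnP invr_expz -expfzDr //.
congr (_ ^ _); lia.
Qed.

Lemma Gtrig_source (C : fieldType) n m (q z : C) (u : n.-tuple C) (v : m.-tuple C) :
  Gtrig q z u v = qpoch_ratio n m q z
    * source_sum q (qmn n m q * z) n m (fun i => u`_i) (fun i => v`_i).
Proof.
congr (_ * _); apply: eq_bigr => K _; congr (_ * _).
apply: eq_bigr => i _; apply: eq_bigr => k _.
by rewrite -opprB -(opprB (q * _)) invrN mulrNN.
Qed.

(** The powers of q met when [source_sum] at p = 1/q is rewritten in
the form of F, for a subset of k of the m nodes: the weight, the factor
p ^ (k (k - 1) / 2), a factor 1/q for each pair in K times its complement,
and a factor q for each of the n k mixed denominators. *)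
Lemma inverse_weight (C : fieldType) n m k (q : C) : q != 0 -> (k <= m)%N ->
  (qmn n m q / q) ^+ k * q^-1 ^+ (k * k.-1)./2 * (q^-1 ^+ (m - k) ^+ k)
    * (q ^+ n ^+ k) = q ^+ (k * k.-1)./2.
Proof.
move=> q0 le_km; set T := _./2.
have T2 : (T + T = k * k.-1)%N.
  rewrite addnn -[RHS]odd_double_half -/T [odd _](_ : _ = false) //.
  by case: (k) => // k'; rewrite oddM /= andNb.
have qn0 j : q ^+ j != 0 by rewrite expf_neq0.
have -> : qmn n m q = q ^+ m / q ^+ n by rewrite -(qmnM n m q0) mulfK.
(* the factor clears all negative powers except that of q ^ n, which cancels *)
apply: (mulIf (qn0 (T + k + (m - k) * k)%N)).
rewrite -[RHS]exprD.
have -> : (T + (T + k + (m - k) * k) = m * k)%N.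
  by rewrite !addnA T2; case: (k) le_km => [|k'] /= ?; nia.
rewrite !exprD !exprMn !exprVn -!exprM.
rewrite exprM.
by field; rewrite !qn0 -?exprM ?qn0.
Qed.

Lemma Ftrig_source (C : fieldType) n m (q z : C) (u : n.-tuple C) (v : m.-tuple C) :
  q != 0 ->
  Ftrig q z u v = source_sum q^-1 (z * qmn n m q / q) m n
                    (fun i => v`_i) (fun i => u`_i).
Proof.
move=> q0; apply: eq_bigr => K _.
have cK : #|[pred j | j \notin K]| = (m - #|K|)%N.
  have := cardC (mem K); rewrite card_ord => E.
  by apply: (@addnI #|K|); rewrite subnKC // -[X in (_ <= X)%N]E leq_addr.
have -> : \prod_(i in K) \prod_(j | j \notin K)
     ((q^-1 * v`_i - v`_j) / (v`_i - v`_j)) =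
   q^-1 ^+ (m - #|K|) ^+ #|K| * \prod_(i in K) \prod_(j | j \notin K)
     ((v`_i - q * v`_j) / (v`_i - v`_j)).
  rewrite -prodr_const -big_split; apply: eq_bigr => i _ /=.
  rewrite -cK -prodr_const -big_split; apply: eq_bigr => j _ /=.
  by rewrite mulrA mulrBr mulKf.
have -> : \prod_(i in K) \prod_(k < n) ((v`_i - u`_k) / (q^-1 * v`_i - u`_k)) =
   q ^+ n ^+ #|K| * \prod_(i in K) \prod_(k < n)
     ((v`_i - u`_k) / (v`_i - q * u`_k)).
  rewrite -prodr_const -big_split; apply: eq_bigr => i _ /=.
  rewrite -[in X in _ ^+ X](card_ord n) -prodr_const -big_split.
  apply: eq_bigr => j _ /=.
  have -> : v`_i - q * u`_j = q * (q^-1 * v`_i - u`_j) by rewrite mulrBr mulVKf.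
  by rewrite invfM mulrCA mulVKf.
have le_K : (#|K| <= m)%N by rewrite -[X in (_ <= X)%N](card_ord m) max_card.
rewrite -{1}(inverse_weight n q0 le_K).
have -> : - (z * qmn n m q / q) = - z * (qmn n m q / q) by rewrite -mulrA mulNr.
rewrite [in RHS]exprMn; ring.
Qed.

(** * The determinant formulas *)

Theorem proposition3p4 (R : realType) (m n : nat) (hm : (0 < m)%N)
    (hn : (0 < n)%N) (q z : R[i]) (u : n.-tuple R[i]) (v : m.-tuple R[i])
    (hgp : general_position q z u v) :
  ((m <= n)%N ->
     Ftrig q z u v = prefactor_ge u v * \det (matY q z u v)
     /\ Gtrig q z u v =
          qpoch_ratio n m q z * prefactor_ge u v * \det (matZ q z u v))
  /\
  ((n < m)%N ->
     Ftrig q z u v = prefactor_lt u v * \det (matU q z u v)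
     /\ Gtrig q z u v =
          qpoch_ratio n m q z * prefactor_lt u v * \det (matV q z u v)).
Proof.
have [q0 uD vD uvD _] := hgp.
rewrite Gtrig_source Ftrig_source //.
split=> [le_mn|/ltnW le_nm].
  have vuD (i : 'I_m) (k : 'I_n) : v`_i - u`_k != 0 by case: (uvD i k).
  have -> : prefactor_ge u v = CVprefactor m n (fun i => v`_i) (fun i => u`_i) by [].
  split; last rewrite -mulrA; [|congr (_ * _)].
  - rewrite (source_rows le_mn) //; last first.
      move=> i k; case: (uvD i k) => _.
      rewrite -(mulVKf q0 v`_i) -mulrBr.
      by rewrite mulKf // mulf_eq0 negb_or => /andP[].
    congr (_ * \det _); apply/matrixP => i j; rewrite !mxE; case: ifP => // _.
    congr (_ - _).
    by rewrite -[in RHS](mulVKf q0 v`_i) -mulrBr invfM [RHS]mulrA.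
  - rewrite (source_cols le_mn) //; last by move=> i k; case: (uvD i k).
    congr (_ * \det _); apply/matrixP => i j; rewrite !mxE; case: ifP => // _.
    by rewrite exprMn -(@qmn_pow _ n) //; ring.
have uvD' (i : 'I_n) (k : 'I_m) : u`_i - v`_k != 0.
  by rewrite -opprB oppr_eq0; case: (uvD k i).
have quvD (i : 'I_n) (k : 'I_m) : q * u`_i - v`_k != 0.
  by rewrite -opprB oppr_eq0; case: (uvD k i).
have -> : prefactor_lt u v = CVprefactor n m (fun i => u`_i) (fun i => v`_i).
  by rewrite /prefactor_lt exchange_big [X in _ / X]mulrC.
split; last rewrite -mulrA; [|congr (_ * _)].
- rewrite (source_cols le_nm) //; last first.
    move=> i k; move: (quvD i k).
    by rewrite -{1}(mulVKf q0 v`_k) -mulrBr mulf_eq0 negb_or => /andP[].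
  congr (_ * \det _); apply/matrixP => i j; rewrite !mxE; case: ifP => // _.
    congr (_ - _).
    by rewrite -[in RHS](mulVKf q0 v`_j) -[in RHS]mulrBr invfM [RHS]mulrA.
  by rewrite exprMn -(@qmn_powV _ n m) //; ring.
- by rewrite (source_rows le_nm).
Qed.
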